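(* The leader's problem $\sup_{\tau\in\mathbb{T}_t}V_{t,x}(\tau)$ may be time inconsistent. That is, the property $$\tau^*_{t,x}(\omega)=\tau^*_{s,X^{t,x}_s}(\omega)\quad\text{for a.e. }\omega\in\{\tau^*_{t,x}\ge s\}$$ may not hold for some $x\in\mathbb{X}$ and $s,t\in\{0,\dots,T\}$ with $s>t$, where $\tau^*_{t,x}$ denotes a pure precommitment stopping strategy with respect to the initial time $t$ and state $x$.
   Context: Let $N,T\in\mathbb{N}$ and let $X=(X_t)$ be a time-homogeneous discrete-time Markov chain on $\mathbb{X}=\{1,\dots,N\}$; $X^{t,x}$ denotes the chain started at time $t$ from $x$; $\mathbb{P}_{t,x},\mathbb{E}_{t,x}$ are the probability and expectation given $X_t=x$. $\mathbb{T}_t$ is the set of stopping times $\tau$ of the filtration $(\mathcal{F}^X_s)$ generated by $X$ with $t\le\tau\le T$. Let $f_i,g_i,h_i:\{0,\dots,T\}\times\mathbb{X}\to\mathbb{R}$ ($i=1,2$) be payoff functions. For stopping times $\tau$ (leader, Player 1) and $\rho$ (follower, Player 2), $$F_1(\tau,\rho)=f_1(\tau,X_\tau)1_{\{\tau<\rho\}}+g_1(\rho,X_\rho)1_{\{\rho<\tau\}}+h_1(\tau,X_\tau)1_{\{\rho=\tau\}},$$ $$F_2(\tau,\rho)=f_2(\rho,X_\rho)1_{\{\rho<\tau\}}+g_2(\tau,X_\tau)1_{\{\tau<\rho\}}+h_2(\rho,X_\rho)1_{\{\rho=\tau\}}.$$ Given $\tau\in\mathbb{T}_t$, the follower uses his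 earliest optimal response $\rho^*(\tau)=\rho^*_{t,x}(\tau):=\inf\{s\ge t: F_2(\tau,s)=\sup_{\rho\in\mathbb{T}_s}\mathbb{E}[F_2(\tau,\rho)\mid\mathcal{F}^X_s]\}$. The leader's value is $V_{t,x}(\tau):=\mathbb{E}_{t,x}[F_1(\tau,\rho^*(\tau))]$. For fixed $t$ and $x$, a stopping time $\tau^*_{t,x}\in\mathbb{T}_t$ is called a pure precommitment stopping strategy (with respect to the initial time $t$) if $V_{t,x}(\tau^*_{t,x})=\sup_{\tau\in\mathbb{T}_t}V_{t,x}(\tau)$. *)

(* Defs.v *)
From HB Require Import structures.
From mathcomp Require Import all_boot all_order all_algebra.
From mathcomp Require Import classical_sets reals.

Set Implicit Arguments.
Unset Strict Implicit.
Unset Printing Implicit Defensive.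

Import Order.TTheory GRing.Theory Num.Theory.
Local Open Scope ring_scope.

(* Time-homogeneous Markov chain on 'I_N (standing for {1, ..., N}): its
   initial law and its one-step transition probabilities. *)
Record chain (R : realType) (N : nat) := Chain {
  init : 'I_N -> R;
  trans : 'I_N -> 'I_N -> R;
  init_ge0 : forall x, 0 <= init x;
  init_sum1 : \sum_x init x = 1;
  trans_ge0 : forall x y, 0 <= trans x y;
  trans_sum1 : forall x, \sum_y trans x y = 1 }.

(* Payoffs of the leader (1) and of the follower (2). *)
Record game (R : realType) (N T : nat) := Game {
  f1 : 'I_T.+1 -> 'I_N -> R;
  g1 : 'I_T.+1 -> 'I_N -> R;
  h1 : 'I_T.+1 -> 'I_N -> R;
  f2 : 'I_T.+1 -> 'I_N -> R;
  g2 : 'I_T.+1 -> 'I_N -> R;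
  h2 : 'I_T.+1 -> 'I_N -> R }.

(* The chain is realized as the coordinate process X_s(w) = w s on the finite
   canonical space of paths. *)
Notation sample_path N T := {ffun 'I_T.+1 -> 'I_N}.

Notation rtime N T := {ffun sample_path N T -> 'I_T.+1}.

Section Model.
Variables (R : realType) (N T : nat).
Implicit Types (X : chain R N) (G : game R N T) (t s : 'I_T.+1) (x : 'I_N).
Implicit Types (w : sample_path N T) (tau rho : rtime N T) (A : {set sample_path N T}).
Implicit Types (Y : sample_path N T -> R).

Definition law X w : R :=
  init X (w ord0) * \prod_(i < T) trans X (w (inord i)) (w (inord i.+1)).

(* The conditional expectation of Y given A; as x / 0 = 0, it is 0 when A is
   null. *)
Definition cexpect X A Y : R :=
  (\sum_(w in A) law X w * Y w) / (\sum_(w in A) law X w).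

(* The expectation E_{t,x} and the probability P_{t,x}, given X_t = x. *)
Definition expect_at X t x Y : R := cexpect X [set w : sample_path N T | w t == x] Y.

Definition prob_at X t x A : R := expect_at X t x (fun w => (w \in A)%:R).

Definition agree s w w' : bool :=
  [forall u : 'I_T.+1, (u <= s)%N ==> (w u == w' u)].

(* A belongs to the sigma-algebra generated by X_0, ..., X_s: the atoms of the
   latter are the classes of paths which agree up to time s. *)
Definition filtration s A : Prop :=
  forall w w', agree s w w' -> (w \in A) = (w' \in A).

(* E[Y | F_s], computed on the atom of F_s which contains w. *)
Definition cond_expect X s Y w : R := cexpect X [set w' : sample_path N T | agree s w w'] Y.

Definition stopping_time tau : Prop :=
  forall s, filtration s [set w : sample_path N T | (tau w <= s)%N].

Definition stopping_times t : set (rtime N T) :=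
  fun tau => stopping_time tau /\ forall w, (t <= tau w)%N.

Definition F1 G tau rho w : R :=
  f1 G (tau w) (w (tau w)) * (tau w < rho w)%N%:R +
  g1 G (rho w) (w (rho w)) * (rho w < tau w)%N%:R +
  h1 G (tau w) (w (tau w)) * (rho w == tau w)%:R.

Definition F2 G tau rho w : R :=
  f2 G (rho w) (w (rho w)) * (rho w < tau w)%N%:R +
  g2 G (tau w) (w (tau w)) * (tau w < rho w)%N%:R +
  h2 G (rho w) (w (rho w)) * (rho w == tau w)%:R.

(* There are finitely many stopping times, so that the pointwise supremum is
   also the essential supremum. *)
Definition follower_value X G tau s w : R :=
  sup [set cond_expect X s (F2 G tau rho) w | rho in stopping_times s]%classic.

(* rho*_{t,x}(tau). It does not depend on x, since F_s already determines X_t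
   for s >= t. At s = T the equality holds on every path of positive
   probability, so that the default value T matters only on null paths. *)
Definition rho_star X G t tau : rtime N T :=
  [ffun w => \big[Order.min/ord_max]_(s : 'I_T.+1 | (t <= s)%N &&
      (F2 G tau [ffun=> s] w == follower_value X G tau s w)) s].

Definition leader_value X G t x tau : R :=
  expect_at X t x (F1 G tau (rho_star X G t tau)).

Definition precommitment X G t x tau : Prop :=
  stopping_times t tau /\
  leader_value X G t x tau =
    sup [set leader_value X G t x tau' | tau' in stopping_times t]%classic.

(* tau*_{t,x}(w) = tau*_{s,X_s(w)}(w) for P_{t,x}-almost every w such that
   tau*_{t,x}(w) >= s. *)
Definition time_consistent_at X (taus : 'I_T.+1 -> 'I_N -> rtime N T)
    t s x : Prop :=
  prob_at X t x
    [set w : sample_path N T | (s <= taus t x w)%N && (taus t x w != taus s (w s) w)] = 0.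

End Model.

(* Main.v *)
Require Import Defs.
From mathcomp Require Import all_boot all_order all_algebra.
From mathcomp Require Import boolp classical_sets reals.

(** The deterministic game on one state with three dates already exhibits the
    phenomenon.  If the leader announces the date 2, the follower preempts him at
    once at the date 0, where he earns 1 and the leader earns 0; if the leader
    announces the date 1, the follower waits in order to earn 2 and the leader
    earns 1.  So at the date 0 the leader commits himself to the date 1.  At the
    date 1, where neither player has stopped, preemption at the date 0 is no
    longer possible: against the date 2 the follower now stops at the date 1,
    which pays 2 to the leader, who prefers the date 2 to the date 1. *)

Set Implicit Arguments.
Unset Strict Implicit.
Unset Printing Implicit Defensive.

Import Order.TTheory GRing.Theory Num.Theory.
Local Open Scope ring_scope.

(** Finiteness of [I] bounds the image, so [sup] is a genuine least upper bound; the suprema of both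
    players thus become plain comparisons. *)
Lemma eq_sup_image_fin (R : realType) (I : finType) (A : set I) (f : I -> R) i :
  A i ->
  (f i = sup [set f j | j in A]%classic) <-> (forall j, A j -> f j <= f i).
Proof.
move=> Ai; have ubA : has_ubound [set f j | j in A]%classic.
  exists (\big[Order.max/f i]_j f j) => _ [j _ <-]; exact: le_bigmax.
split=> [-> j Aj | le_f].
  by apply: ub_le_sup => //; exists j.
apply/le_anti/andP; split; first by apply: ub_le_sup => //; exists i.
by apply: ge_sup => [|_ [j Aj <-]]; [exists (f i), i | exact: le_f].
Qed.

Lemma constant_stopping_time N T (t c : 'I_T.+1) :
  (t <= c)%N -> stopping_times t ([ffun=> c] : rtime N T).
Proof.
by move=> tc; split=> [s w w' _ | w]; rewrite ?inE !ffunE.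
Qed.

Lemma precommitmentP (R : realType) N T (X : chain R N) (G : game R N T)
    t x tau :
  precommitment X G t x tau <->
  stopping_times t tau /\
  forall tau', stopping_times t tau' ->
    leader_value X G t x tau' <= leader_value X G t x tau.
Proof.
by split=> -[tau_t] /(eq_sup_image_fin (leader_value X G t x) tau_t).
Qed.

(** There are finitely many random times and the constant [t] is admissible, so a maximizer exists.
    This keeps the final negative claim from being vacuous. *)
Lemma precommitment_exists (R : realType) N T (X : chain R N)
    (G : game R N T) t x :
  exists tau, precommitment X G t x tau.
Proof.
pose P : pred (rtime N T) := fun tau => `[< stopping_times t tau >].
have Pt : P [ffun=> t] by exact/asboolP/constant_stopping_time.
case: (Order.TotalTheory.arg_maxP (leader_value X G t x) Pt) => tau.
move=> /asboolP tau_t max_tau.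
by exists tau; apply/precommitmentP; split=> // tau' /asboolP; apply: max_tau.
Qed.

Section OneState.
Variables (R : realType) (T : nat).
Implicit Types (X : chain R 1) (G : game R 1 T) (w : sample_path 1 T).

(** With one state there is a single path: random times are constants, and (conditional)
    expectations are evaluations. *)
Lemma sample_path1_eq w w' : w = w'.
Proof. by apply/ffunP=> u; rewrite !ord1. Qed.

Lemma rtime1_const (tau : rtime 1 T) w : tau = [ffun=> tau w].
Proof. by apply/ffunP=> w'; rewrite ffunE (sample_path1_eq w' w). Qed.

Lemma law1 X w : law X w = 1.
Proof.
have i1 : init X ord0 = 1 by rewrite -(init_sum1 X) big_ord1.
have t1 : trans X ord0 ord0 = 1 by rewrite -(trans_sum1 X ord0) big_ord1.
by rewrite /law big1 => [|i _]; rewrite !ord1 ?i1 ?mulr1.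
Qed.

Lemma cexpect1 X (A : {set sample_path 1 T}) Y w :
  w \in A -> cexpect X A Y = Y w.
Proof.
move=> wA; have A1 : A =i pred1 w.
  by move=> w'; rewrite (sample_path1_eq w' w) wA inE eqxx.
by rewrite /cexpect !(big_pred1 w A1) law1 mul1r divr1.
Qed.

Lemma expect_at1 X t x Y w : expect_at X t x Y = Y w.
Proof. by apply: cexpect1; rewrite inE !ord1. Qed.

Lemma cond_expect1 X s Y w : cond_expect X s Y w = Y w.
Proof. by apply: cexpect1; rewrite inE; apply/forallP=> u; rewrite eqxx implybT. Qed.

(** Stopping times being constant, the follower only compares the dates [r] from [s] on. *)
Lemma follower_value1P X G tau (s : 'I_T.+1) w :
  (F2 G tau [ffun=> s] w == follower_value X G tau s w) =
  [forall r : 'I_T.+1, (s <= r)%N ==>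
     (F2 G tau [ffun=> r] w <= F2 G tau [ffun=> s] w)].
Proof.
have s_s := constant_stopping_time 1 (leqnn s).
have E := eq_sup_image_fin (fun rho => cond_expect X s (F2 G tau rho) w) s_s.
apply/eqP/forallP => [|max_s].
  rewrite -{1}(cond_expect1 X s (F2 G tau [ffun=> s])) => /E max_s r.
  apply/implyP=> sr; have := max_s _ (constant_stopping_time 1 sr).
  by rewrite !cond_expect1.
rewrite -(cond_expect1 X s (F2 G tau [ffun=> s])); apply/E => rho [_ /(_ w) s_rho].
by rewrite !cond_expect1 (rtime1_const rho w); apply: (implyP (max_s _)).
Qed.

End OneState.

Section Counterexample.
Variable R : realType.

Let ge01 (x : 'I_1) : 0 <= (1 : R).
Proof. exact: ler01. Qed.

Let sum1 : \sum_(x : 'I_1) (1 : R) = 1.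
Proof. by rewrite big_ord1. Qed.

Definition one_state_chain : chain R 1 :=
  Chain ge01 sum1 (fun _ => ge01) (fun _ => sum1).

Definition preemption_game : game R 1 2 :=
  @Game R 1 2
    (fun s _ => (s == 1 :> nat)%:R) (fun s _ => (2 * (s == 1 :> nat))%:R)
    (fun _ _ => 0)
    (fun s _ => (s == 0 :> nat)%:R) (fun s _ => (2 * (s == 1 :> nat))%:R)
    (fun _ _ => 0).

Notation X := one_state_chain.
Notation G := preemption_game.
Notation const c := ([ffun=> c] : rtime 1 2).

Lemma preemption_F1 (c r : 'I_3) w :
  F1 G (const c) (const r) w =
  ((c == 1 :> nat) * (c < r) + 2 * (r == 1 :> nat) * (r < c))%:R.
Proof. by rewrite /F1 !ffunE /= mul0r addr0 natrD !natrM. Qed.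

Lemma preemption_F2 (c r : 'I_3) w :
  F2 G (const c) (const r) w =
  ((r == 0 :> nat) * (r < c) + 2 * (c == 1 :> nat) * (c < r))%:R.
Proof. by rewrite /F2 !ffunE /= mul0r addr0 natrD !natrM. Qed.

Lemma preemption_rho_star (t c : 'I_3) w :
  rho_star X G t (const c) w =
  \big[Order.min/ord_max]_(s < 3 | (t <= s)%N &&
     [forall r : 'I_3, (s <= r)%N ==>
       ((r == 0 :> nat) * (r < c) + 2 * (c == 1 :> nat) * (c < r) <=
        (s == 0 :> nat) * (s < c) + 2 * (c == 1 :> nat) * (c < s))%N]) s.
Proof.
rewrite /rho_star ffunE; apply: eq_bigl => s; congr (_ && _).
by rewrite follower_value1P; apply: eq_forallb => r; rewrite !preemption_F2 ler_nat.
Qed.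

Definition preemption_value (t c : 'I_3) : nat :=
  if c == 1 :> nat then 1 else if (t == 1 :> nat) then 2 else 0.

Lemma enum_ord3 : enum 'I_3 = [:: ord0; @Ordinal 3 1 isT; ord_max].
Proof. by apply: (inj_map val_inj); rewrite val_enum_ord. Qed.

Lemma forall_ord3 (P : pred 'I_3) :
  [forall r, P r] = [&& P ord0, P (@Ordinal 3 1 isT) & P ord_max].
Proof.
apply/forallP/idP=> [allP | P3 r]; first by rewrite !allP.
have : all P (enum 'I_3) by rewrite enum_ord3 /= andbT.
by move=> /allP; apply; rewrite mem_enum.
Qed.

Lemma preemption_leader_value (t c : 'I_3) x : (t <= 1)%N -> (t <= c)%N ->
  leader_value X G t x (const c) = (preemption_value t c)%:R.
Proof.
pose w : sample_path 1 2 := [ffun=> ord0].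
move=> t1 tc; rewrite /leader_value (expect_at1 _ _ _ _ w).
rewrite (rtime1_const (rho_star _ _ _ _) w) preemption_F1 preemption_rho_star.
(* Listing the three dates explicitly makes the earliest best response computable for each concrete
   [t] and [c]. For [t = 1], [c = 2] all follower payoffs vanish, and the tie is broken by the
   earliest date, 1. *)
congr (_%:R); rewrite [index_enum _]unlock -enumT enum_ord3.
rewrite !big_cons big_nil !forall_ord3.
by case: t c t1 tc => [[|[|//]] ?] [[|[|[|//]]] ?].
Qed.

(** The optimum is unique, so inconsistency will hold for every selection of optimizers: date 1
    earns 1 against 0 from [t = 0], date 2 earns 2 against 1 from [t = 1]. *)
Lemma preemption_precommitment (t : 'I_3) x tau w :
  precommitment X G t x tau -> (t <= 1)%N -> tau w = t.+1 :> nat.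
Proof.
move=> /precommitmentP[[_ /(_ w) t_tau] max_tau] t1.
have tS : (t.+1 < 3)%N by [].
have := max_tau _ (@constant_stopping_time 1 _ t (Ordinal tS) (leqnSn t)).
rewrite (rtime1_const tau w) !preemption_leader_value // ler_nat ffunE.
by case: t (tau w) t1 t_tau tS {max_tau} => [[|[|//]] ?] [[|[|[|//]]] ?].
Qed.

End Counterexample.

Theorem proposition2p2 (R : realType) :
  exists (N T : nat) (X : chain R N) (G : game R N T)
         (x : 'I_N) (t s : 'I_T.+1),
    (t < s)%N /\
    (exists taus : 'I_T.+1 -> 'I_N -> rtime N T,
       forall u y, precommitment X G u y (taus u y)) /\
    (forall taus : 'I_T.+1 -> 'I_N -> rtime N T,
       (forall u y, precommitment X G u y (taus u y)) ->
       ~ time_consistent_at X taus t s x).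
Proof.
exists 1%N, 2%N, (one_state_chain R), (preemption_game R), ord0, ord0, (inord 1).
rewrite inordK //; split=> //; split.
  have ex u := choice (precommitment_exists (one_state_chain R) (preemption_game R) u).
  by exists (fun u => projT1 (ex u)) => u; apply: projT2 (ex u).
move=> taus taus_opt; pose w : sample_path 1 2 := [ffun=> ord0].
have tau0 := preemption_precommitment w (taus_opt ord0 ord0) isT.
have s1 : (@inord 2 1 <= 1)%N by rewrite inordK.
have tau1 := preemption_precommitment w (taus_opt (inord 1) (w (inord 1))) s1.
(* On the only path the optimizer from 0 stops at 1, hence not before [s = 1], while the one from 1
   stops at 2: the exceptional set has probability 1. *)
rewrite /time_consistent_at /prob_at (expect_at1 _ _ _ _ w) inE.
rewrite -(inj_eq val_inj) /= tau0 tau1 inordK //=.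
by apply/eqP; rewrite oner_eq0.
Qed.
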